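(* Let $n,m\ge 2$ be integers with $n\le m$, let $d=m+n$, and let $\Theta$ be a real $n\times m$ matrix which is completely irrational and good. Then $R(\Theta)\ge n+2$.
   Context: Write vectors of $\mathbb{R}^d$ as $\pmb{z}=(\pmb{x},\pmb{y})^\top$ with $\pmb{x}\in\mathbb{R}^m$, $\pmb{y}\in\mathbb{R}^n$. For $\pmb{\xi}\in\mathbb{R}^k$ let $|\pmb{\xi}|=\max_j|\xi_j|$ (sup-norm) and $\|\pmb{\xi}\|=\min_{\pmb{a}\in\mathbb{Z}^k}|\pmb{\xi}-\pmb{a}|$. A linear subspace $\mathcal{R}\subset\mathbb{R}^d$ of dimension $r$ is rational if $\mathcal{R}\cap\mathbb{Z}^d$ is a lattice of rank $r$. The matrix $\Theta$ (equivalently the $m$-dimensional subspace $\mathcal{L}_\Theta=\{\pmb{z}:\pmb{y}=\Theta\pmb{x}\}$) is completely irrational if $\mathcal{L}_\Theta\cap\mathcal{R}=\{\pmb{0}\}$ for every rational subspace $\mathcal{R}$ of dimension $n$. A nonzero integer vector $\pmb{x}\in\mathbb{Z}^m$ is a best approximation for $\Theta$ if $\|\Theta\pmb{x}\|<\|\Theta\pmb{x}'\|$ for all nonzero integer $\pmb{x}'$ with $|\pmb{x}'|\le|\pmb{x}|$, $\pmb{x}'\ne\pm\pmb{x}$; its extended vector is $\pmb{z}=(\pmb{x},\pmb{y})^\top$ where $\pmb{y}\in\mathbb{Z}^n$ satisfies $|\Theta\pmb{x}-\pmb{y}|=\|\Theta\pmb{x}\|$. $\Theta$ is called good if the sequence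 of extended best approximation vectors $\pm\pmb{z}_\nu=\pm(\pmb{x}_\nu,\pmb{y}_\nu)^\top$, $\nu=1,2,\dots$, with $|\pmb{x}_1|<|\pmb{x}_2|<\cdots$ and $\|\Theta\pmb{x}_1\|>\|\Theta\pmb{x}_2\|>\cdots$, is uniquely determined (up to sign of each term). For good $\Theta$, $R(\Theta)$ is the least integer $s$ such that there exist a linear subspace $\mathcal{R}\subset\mathbb{R}^d$ of dimension $s$ and $\nu_0$ with $\pmb{z}_\nu\in\mathcal{R}$ for all $\nu\ge\nu_0$. *)

(* Defs.v *)
From mathcomp Require Import all_boot all_order all_algebra.
From mathcomp Require Import boolp classical_sets reals topology normedtype.

Set Implicit Arguments.
Unset Strict Implicit.
Unset Printing Implicit Defensive.

Import Order.TTheory GRing.Theory Num.Theory.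
Import numFieldNormedType.Exports.

Local Open Scope classical_set_scope.
Local Open Scope ring_scope.

Section Definitions.
Variable R : realType.

(* On real matrices `|_| is the sup-norm (mx_norm). *)
Definition intv k (a : 'cV[int]_k) : 'cV[R]_k := map_mx intr a.

(* The infimum is a minimum, see distZ_attained below. *)
Definition distZ k (xi : 'cV[R]_k) : R :=
  inf [set `|xi - intv a| | a in [set: 'cV[int]_k]].

Definition is_lattice k (A : set 'cV[R]_k) (r : nat) : Prop :=
  exists b : r.-tuple 'cV[R]_k, free b /\
    A = [set \sum_(i < r) (c i)%:~R *: b`_i | c in [set: 'I_r -> int]].

Definition rational k (V : {vspace 'cV[R]_k}) : Prop :=
  is_lattice ([set z | z \in V] `&` range (@intv k)) (\dim V).

Section Matrix.
Variables n m : nat.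
Variable Theta : 'M[R]_(n, m).

(* A vector z of R^(m + n) is (x, y) with x = usubmx z and y = dsubmx z. *)
Definition graph : set 'cV[R]_(m + n) :=
  [set z | dsubmx z = Theta *m usubmx z].

Definition completely_irrational : Prop :=
  forall V : {vspace 'cV[R]_(m + n)}, rational V -> \dim V = n ->
    graph `&` [set z | z \in V] = [set 0].

Definition best_approx (x : 'cV[int]_m) : Prop :=
  x != 0 /\
  forall x' : 'cV[int]_m, x' != 0 -> `|intv x'| <= `|intv x| ->
    x' != x -> x' != - x ->
    distZ (Theta *m intv x) < distZ (Theta *m intv x').

Definition extended_best_approx (z : 'cV[int]_(m + n)) : Prop :=
  best_approx (usubmx z) /\
  `|Theta *m intv (usubmx z) - intv (dsubmx z)|
    = distZ (Theta *m intv (usubmx z)).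

(* A complete sequence of extended best approximations, indexed from 0, with
   one representative of each pair z, - z.  Completeness (bas_complete) says
   that the minimum of distZ (Theta *m x) over 0 < |x| <= t is reached on the
   sequence for every t >= 1.  It implies that every best approximation occurs
   up to sign (best_approx_listed below), and it excludes ties: if two vectors
   x' <> +- x share a minimum, neither is a best approximation, and the step of
   the sequence realising that minimum is not uniquely determined. *)
Record best_approx_sequence (z : nat -> 'cV[int]_(m + n)) : Prop :=
  BestApproxSequence {
    bas_extended : forall nu, extended_best_approx (z nu);
    bas_norm : forall nu,
      `|intv (usubmx (z nu))| < `|intv (usubmx (z nu.+1))|;
    bas_dist : forall nu,
      distZ (Theta *m intv (usubmx (z nu.+1)))
        < distZ (Theta *m intv (usubmx (z nu)));
    bas_complete : forall x : 'cV[int]_m, x != 0 ->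
      exists nu, `|intv (usubmx (z nu))| <= `|intv x| /\
        distZ (Theta *m intv (usubmx (z nu))) <= distZ (Theta *m intv x) }.

Definition good : Prop :=
  exists z, best_approx_sequence z /\
    forall z', best_approx_sequence z' ->
      forall nu, z' nu = z nu \/ z' nu = - z nu.

Definition eventually_in_dim (s : nat) : Prop :=
  exists z, best_approx_sequence z /\
  exists V : {vspace 'cV[R]_(m + n)}, \dim V = s /\
  exists nu0, forall nu, (nu0 <= nu)%N -> intv (z nu) \in V.

(* The least s with eventually_in_dim s, see asym_dimP below; the value 0 is a
   default for Theta without a sequence of best approximations. *)
Definition asym_dim : nat :=
  if pselect (exists s, `[< eventually_in_dim s >]) is left ex
  then ex_minn ex else 0%N.

Lemma best_approx_listed z x : best_approx_sequence z -> best_approx x ->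
  exists nu, x = usubmx (z nu) \/ x = - usubmx (z nu).
Proof.
move=> zP [x0 xP]; have [nu [le_n le_d]] := bas_complete zP x0.
exists nu; apply: contrapT => /not_orP[/eqP nx /eqP nNx].
have [[z0 _] _] := bas_extended zP nu.
have := xP _ z0 le_n; rewrite eq_sym => /(_ nx).
by rewrite eq_sym eqr_oppLR => /(_ nNx); rewrite ltNge le_d.
Qed.

Lemma asym_dimP : good ->
  eventually_in_dim asym_dim /\
  forall s, eventually_in_dim s -> (asym_dim <= s)%N.
Proof.
move=> [z [zP _]]; rewrite /asym_dim; case: pselect => [ex|[]].
  case: ex_minnP => s /asboolP sP smin; split=> // t tP.
  by apply: smin; apply/asboolP.
exists (\dim {: 'cV[R]_(m + n)}); apply/asboolP; exists z; split=> //.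
by exists fullv; split=> //; exists 0%N => nu _; exact: memvf.
Qed.

End Matrix.

Lemma distZ_attained k (xi : 'cV[R]_k) :
  exists2 a, distZ xi = `|xi - intv a| & forall b, `|xi - intv a| <= `|xi - intv b|.
Proof.
pose a : 'cV[int]_k := \col_i Num.floor (xi i 0 + 2^-1).
have round (t : R) (c : int) :
    `|t - (Num.floor (t + 2^-1))%:~R| <= `|t - c%:~R|.
  have half : (2^-1 : R) + 2^-1 = 1 by have := splitr (1 : R); rewrite !div1r.
  have := floor_itv (t + 2^-1); set f := Num.floor _.
  rewrite intrD => /andP[h1 h2].
  have hle : `|t - f%:~R| <= 2^-1.
    rewrite ler_norml lerBrDl lerBlDr h1 /=.
    by rewrite lerBlDl -(lerD2r 2^-1) -addrA half ltW.
  have [->//|ne] := eqVneq c f.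
  have ge1 : 1 <= `|c%:~R - f%:~R : R|.
    by rewrite -intrB -intr_norm ler1z -gtz0_ge1 normr_gt0 subr_eq0.
  apply: (le_trans hle); rewrite -(lerD2r 2^-1).
  rewrite half.
  apply: (le_trans ge1); rewrite [c%:~R - f%:~R](_ : _ =
    - (t - c%:~R) + (t - f%:~R)); last by rewrite opprB addrA subrK.
  by rewrite (le_trans (ler_normD _ _))// normrN lerD2l.
have amin b : `|xi - intv a| <= `|xi - intv b|.
  rewrite [leLHS]/Num.Def.normr [leRHS]/Num.Def.normr /= !mx_normrE.
  apply/bigmax_leP; split=> [|[i j] _ /=]; first by rewrite bigmax_ge_id.
  apply: (le_trans _ (le_bigmax _ _ (i, j))) => /=.
  by rewrite !mxE (ord1 j); exact: round.
exists a => //; apply/eqP; rewrite eq_le; apply/andP; split.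
  apply: ge_inf; last by exists a.
  by exists 0 => _ [b _ <-]; exact: normr_ge0.
by apply: lb_le_inf; [exists `|xi - intv a|, a|move=> _ [b _ <-]].
Qed.

End Definitions.

(* Main.v *)
(** A completely irrational [Theta] meets a rational subspace of dimension
    [n.+1] in at most a line, spanned by some [e].  If the best approximations
    [z_nu] eventually lie in such a subspace, then [z_nu] is within [O(zeta_nu)]
    of this line, where [zeta_nu = ||Theta x_nu||].  As long as [3 <= n.+1],
    infinitely many triples [z_nu, z_nu.+1, z_nu.+2] are independent, and then
    some integral 3 x 3 minor of the triple is nonzero while being
    [O(zeta_nu * zeta_nu.+1 * |x_nu.+2|)].  But [n <= m] and Dirichlet's theorem
    give [zeta_nu.+1 * |x_nu.+2| <= 2], and [zeta_nu] tends to [0]. *)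

Require Import Defs.
From mathcomp Require Import all_boot all_order all_algebra.
From mathcomp Require Import ring lra zify.
From mathcomp Require Import boolp classical_sets reals topology normedtype.

Set Implicit Arguments.
Unset Strict Implicit.
Unset Printing Implicit Defensive.

Import Order.TTheory GRing.Theory Num.Theory.
Import numFieldNormedType.Exports.

Local Open Scope ring_scope.

(** * Sup-norm estimates and integrality of norms *)

Section SupNorm.
Variable R : realType.

Lemma coord_le_norm k (v : 'cV[R]_k) i : `|v i 0| <= `|v|.
Proof.
rewrite [leRHS]/Num.Def.normr /= mx_normrE.
exact: (le_bigmax _ (fun p : 'I_k * 'I_1 => `|v p.1 p.2|) (i, 0)).
Qed.

Lemma norm_le_coord k (v : 'cV[R]_k) (c : R) :
  0 <= c -> (forall i, `|v i 0| <= c) -> `|v| <= c.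
Proof.
move=> c0 vc; rewrite [leLHS]/Num.Def.normr /= mx_normrE.
by apply/bigmax_leP; split=> // -[i j] _ /=; rewrite (ord1 j).
Qed.

Lemma mulmx_norm_bound p q (M : 'M[R]_(p, q)) :
  exists2 C : R, 0 <= C & forall v : 'cV[R]_q, `|M *m v| <= C * `|v|.
Proof.
exists (\sum_i \sum_j `|M i j|).
  by apply: sumr_ge0 => i _; apply: sumr_ge0.
move=> v; have C0 : 0 <= \sum_i \sum_j `|M i j|.
  by apply: sumr_ge0 => i _; apply: sumr_ge0.
apply: norm_le_coord => [|i]; first by rewrite mulr_ge0.
rewrite mxE (le_trans (ler_norm_sum _ _ _))//.
rewrite (bigD1 i)//= mulrDl ler_wpDr//.
  by rewrite mulr_ge0// sumr_ge0// => j _; rewrite sumr_ge0.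
by rewrite mulr_suml ler_sum// => j _; rewrite normrM ler_wpM2l// coord_le_norm.
Qed.

(** Integrality of the norms turns strict growth of [|x_nu|] into growth by at least 1. *)
Lemma intv_norm_nat k (a : 'cV[int]_k) : exists N : nat, `|intv R a| = N%:R.
Proof.
rewrite /Num.Def.normr /= mx_normrE.
elim/big_ind: _ => [|x y [N ->] [M ->]|[i j] _]; first by exists 0%N.
  by exists (maxn N M); rewrite natr_max.
by exists `|a i j|%N; rewrite mxE /= -intr_norm natr_absz.
Qed.

Lemma intv_inj k : injective (@intv R k).
Proof.
move=> a b /matrixP ab; apply/matrixP => i j.
by have := ab i j; rewrite !mxE => /intr_inj.
Qed.

Lemma intv_norm_ge1 k (a : 'cV[int]_k) : a != 0 -> 1 <= `|intv R a|.
Proof.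
move=> a0; have [N aN] := intv_norm_nat a.
rewrite aN ler1n lt0n; apply: contra_neq a0 => N0.
move/eqP: aN; rewrite N0 normr_eq0 => /eqP a0.
by apply: intv_inj; rewrite a0 /intv map_mx0.
Qed.

Lemma intv_mul p q (M : 'M[int]_(p, q)) (a : 'cV[int]_q) :
  intv R (M *m a) = map_mx intr M *m intv R a.
Proof. exact: map_mxM. Qed.

End SupNorm.

(** * Integer points of a real subspace and unimodular coordinates *)

Section IntegerPoints.
Variable R : realType.

(* A maximal R-free family of integer vectors of [V] spans all of them; its
   Smith normal form gives coordinates adapted to [V]. *)
Lemma unimodular_coordinates d (V : {vspace 'cV[R]_d}) :
  exists2 G : 'M[int]_d, G \in unitmx &
  forall a : 'cV[int]_d, intv R a \in V ->
  forall i : 'I_d, (\dim V <= i)%N -> (G *m a) i 0 = 0.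
Proof.
pose P p := `[< exists s : seq 'cV[int]_d, [/\ size s = p,
  free (map (@intv R d) s) & forall a, a \in s -> intv R a \in V] >].
have P_le p : P p -> (p <= \dim V)%N.
  move=> /asboolP [s [<- fs sV]].
  have /eqP <- : \dim <<map (@intv R d) s>> == size s.
    by move: fs; rewrite /free size_map.
  by apply: dimvS; apply/span_subvP => _ /mapP[a /sV ? ->].
have P0 : exists p, P p.
  by exists 0%N; apply/asboolP; exists [::]; split=> //=; rewrite nil_free.
case: (ex_maxnP P0 P_le) => p /[dup] /P_le leV /asboolP [s [sp fs sV]] pmax.
have s_span a : intv R a \in V -> intv R a \in <<map (@intv R d) s>>%VS.
  move=> aV; apply: contraT => aNs; suff /pmax : P p.+1 by rewrite ltnn.
  apply/asboolP; exists (a :: s); split; first by rewrite /= sp.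
    by rewrite /= free_cons aNs.
  by move=> b; rewrite inE => /orP[/eqP->//|/sV].
pose M : 'M[int]_(p, d) := \matrix_(i, j) (s`_i j 0).
have [L _ [U Uu [D _ ME]]] := int_Smith_normal_form M.
(* The rows of [M = L D U] are the family [s]. An integer point of [V] satisfies [a^T = c M], so
   [a^T U^-1 = c L D], whose entries vanish from index [p] on because [D] is diagonal. *)
exists (invmx U)^T => [|a aV i le_i]; first by rewrite unitmx_tr unitmx_inv.
have szs : size (map (@intv R d) s) == p by rewrite size_map sp.
have := s_span _ aV.
rewrite -[map _ _]/(tval (Tuple szs)) => /coord_span.
move: (coord _) => c aE.
have {}aE : (intv R a)^T = (\row_j c j (intv R a)) *m map_mx intr M.
  apply/rowP => j; rewrite !mxE.
  have /matrixP/(_ j 0) := aE.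
  rewrite mxE summxE => ->; apply: eq_bigr => l _.
  by rewrite !mxE /= (nth_map 0) ?sp// mxE.
have : ((intv R a)^T *m map_mx intr (invmx U)) 0 i = 0.
  rewrite aE ME !map_mxM -!mulmxA -map_mxM mulmxV// map_mx1 mulmx1 mulmxA.
  rewrite mxE big1// => l _; rewrite !mxE.
  by rewrite ltn_eqF ?mulr0n ?mulr0// (leq_trans (ltn_ord l))// (leq_trans leV).
have -> : (intv R a)^T = map_mx intr a^T by apply/matrixP => ? ?; rewrite !mxE.
rewrite -map_mxM mxE => /eqP; rewrite intr_eq0 => /eqP <-.
by rewrite -[in LHS](trmxK (_ *m _)) trmx_mul trmxK mxE.
Qed.

(** The first [j] columns of [G^-1] are an integral basis of [W]. They generate every integer point
    [a] of [W] over the integers, since the coefficients of [a] are entries of the integer vector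
    [G a]. *)
Lemma coordinate_subspace_rational d (G : 'M[int]_d) j :
  G \in unitmx -> (j <= d)%N ->
  exists W : {vspace 'cV[R]_d}, [/\ Defs.rational W, \dim W = j &
    forall z : 'cV[R]_d, (z \in W) <->
      forall i : 'I_d, (j <= i)%N -> (map_mx intr G *m z) i 0 = 0].
Proof.
move=> Gu le_jd; pose wi := widen_ord le_jd.
pose U : 'M[R]_d := map_mx intr (invmx G).
pose Gr : 'M[R]_d := map_mx intr G.
have GU : Gr *m U = 1%:M by rewrite -map_mxM mulmxV// map_mx1.
have UG : U *m Gr = 1%:M by rewrite -map_mxM mulVmx// map_mx1.
have [b bE] : exists b : j.-tuple 'cV[R]_d, forall i : 'I_j, b`_i = col (wi i) U.
  by exists [tuple col (wi i) U | i < j] => i; rewrite -tnth_nth tnth_mktuple.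
have Gsum (c : 'I_j -> R) : Gr *m (\sum_i c i *: b`_i) =
    \sum_i c i *: delta_mx (wi i) 0.
  rewrite mulmx_sumr; apply: eq_bigr => i _; rewrite -scalemxAr bE.
  by rewrite colE mulmxA GU mul1mx.
have Gsum_wi (c : 'I_j -> R) i : (Gr *m (\sum_i c i *: b`_i)) (wi i) 0 = c i.
  rewrite Gsum summxE (bigD1 i)//= !mxE !eqxx mulr1 big1 ?addr0// => l li.
  have /negPf wil : wi i != wi l by rewrite eq_sym.
  by rewrite !mxE wil mulr0.
have wi_neq (l : 'I_j) (i : 'I_d) : (j <= i)%N -> (i == wi l) = false.
  by apply: contraTF => /eqP ->; rewrite -ltnNge; exact: (ltn_ord l).
have fb : free b.
  by apply/freeP => f f0 i; rewrite -(Gsum_wi f) f0 mulmx0 mxE.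
have memW z : (z \in <<b>>%VS) <->
    forall i : 'I_d, (j <= i)%N -> (Gr *m z) i 0 = 0.
  split=> [/coord_span -> i le_ji|z0].
    rewrite Gsum summxE big1// => l _; rewrite !mxE.
    by rewrite wi_neq ?mulr0.
  suff -> : z = \sum_(i < j) (Gr *m z) (wi i) 0 *: b`_i.
    rewrite memv_suml// => i _; rewrite memvZ// memv_span// mem_nth//.
    by rewrite size_tuple.
  rewrite -[LHS]mul1mx -UG -mulmxA -[RHS]mul1mx -UG -mulmxA; congr (_ *m _).
  apply/colP => i; case: (ltnP i j) => [lt_ij|/[dup] le_ji /z0 ->].
    have -> : i = wi (Ordinal lt_ij) by apply: val_inj.
    by rewrite Gsum_wi.
  rewrite Gsum summxE big1// => l _; rewrite !mxE.
  by rewrite wi_neq ?mulr0.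
have dimW : \dim <<b>> = j by rewrite (eqP fb) size_tuple.
exists <<b>>%VS; split=> //; rewrite /Defs.rational dimW; exists b; split=> //.
apply/seteqP; split=> [z [/= aW [a _ aE]]|_ [c _ <-]].
  exists (fun i => (G *m a) (wi i) 0) => //; rewrite -aE.
  move: aW; rewrite -aE => /coord_span aW.
  rewrite [RHS]aW; apply: eq_bigr => i _; congr (_ *: _).
  transitivity ((Gr *m intv R a) (wi i) 0); last by rewrite {1}aW Gsum_wi.
  by rewrite -intv_mul [RHS]mxE.
split=> /=.
  rewrite memv_suml// => i _; rewrite memvZ// memv_span// mem_nth//.
  by rewrite size_tuple.
exists (\sum_i c i *: col (wi i) (invmx G)) => //.
apply/colP => r; rewrite mxE !summxE rmorph_sum; apply: eq_bigr => i _.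
by rewrite bE !mxE rmorphM.
Qed.

End IntegerPoints.

(** * Distance from integer points to the graph of [Theta] inside a subspace *)

Section Kernel.
Variable R : realType.

(* The pseudo-inverse of [F *m B] gives the point of the kernel. *)
Lemma dist_kernel_bound p d q (F : 'M[R]_(p, d)) (B : 'M[R]_(d, q)) :
  exists2 C : R, 0 <= C & forall w : 'cV[R]_q, exists w' : 'cV[R]_q,
    F *m (B *m w') = 0 /\ `|B *m w - B *m w'| <= C * `|F *m (B *m w)|.
Proof.
pose A := F *m B; have [C C0 CP] := mulmx_norm_bound (B *m pinvmx A).
exists C => // w; exists (w - pinvmx A *m (A *m w)); split.
  have AKA : A *m (pinvmx A *m (A *m w)) = A *m w.
    by rewrite 2!mulmxA mulmxKpV.
  by rewrite mulmxA -/A mulmxBr AKA subrr.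
rewrite -mulmxBr opprB addrCA subrr addr0 (mulmxA F) -/A (mulmxA B).
exact: CP.
Qed.

Variables (n m : nat) (Theta : 'M[R]_(n, m)).

(** Its kernel is [graph Theta]; its norm at an extended best approximation is [zeta_nu]. *)
Definition residual_mx : 'M[R]_(n, m + n) := row_mx Theta (- 1%:M).

Lemma residual_mxE (z : 'cV[R]_(m + n)) :
  residual_mx *m z = Theta *m usubmx z - dsubmx z.
Proof. by rewrite -{1}(vsubmxK z) mul_row_col mulNmx mul1mx. Qed.

(** [V] need not be rational, so it is replaced by a rational coordinate subspace [S k] containing
    its integer points. Complete irrationality makes the kernel of [residual_mx] trivial in [S n];
    one more coordinate allows at most a line. The case [e = 0] serves to rule out subspaces of
    dimension at most [n]. *)
Lemma near_line (V : {vspace 'cV[R]_(m + n)}) :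
  completely_irrational Theta -> (\dim V < m + n)%N -> (\dim V <= n.+1)%N ->
  exists e : 'cV[R]_(m + n), ((\dim V <= n)%N -> e = 0) /\
  exists2 C : R, 0 <= C & forall a : 'cV[int]_(m + n), intv R a \in V ->
    exists t, `|intv R a - t *: e| <= C * `|residual_mx *m intv R a|.
Proof.
move=> irr ltVd leVn; have [G Gu GP] := unimodular_coordinates V.
pose U : 'M[R]_(m + n) := map_mx intr (invmx G).
pose Gr : 'M[R]_(m + n) := map_mx intr G.
have GU : Gr *m U = 1%:M by rewrite -map_mxM mulmxV// map_mx1.
have UG : U *m Gr = 1%:M by rewrite -map_mxM mulVmx// map_mx1.
pose S k (z : 'cV[R]_(m + n)) := forall i : 'I__, (k <= i)%N -> (Gr *m z) i 0 = 0.
have [W [ratW dimW memW]] := coordinate_subspace_rational R Gu (leq_addl m n).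
have ker0 z : S n z -> residual_mx *m z = 0 -> z = 0.
  move=> /memW zW; rewrite residual_mxE => /eqP; rewrite subr_eq0 => /eqP Tz.
  have : (graph Theta `&` [set` W])%classic z by split.
  by rewrite irr.
have [k [leVk e_line]] : exists k, (\dim V <= k)%N /\
    exists e : 'cV[R]_(m + n), ((\dim V <= n)%N -> e = 0) /\
    forall z, S k z -> residual_mx *m z = 0 -> exists t, z = t *: e.
  have [leV|ltV] := leqP (\dim V) n.
    (* Complete irrationality concerns dimension exactly [n], so a smaller [V] is treated inside
       [S n]. *)
    exists n; split=> //; exists 0; split=> // z Sz /(ker0 _ Sz) ->.
    by exists 0; rewrite scaler0.
  exists n.+1; split=> //.
  have [[e [Se [Fe e0]]]|none] :=
      pselect (exists e, S n.+1 e /\ residual_mx *m e = 0 /\ e <> 0).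
    exists e; split=> // z Sz Fz.
    have ltn : (n < m + n)%N by apply: leq_trans ltV (ltnW ltVd).
    have Sn z' : S n.+1 z' -> (Gr *m z') (Ordinal ltn) 0 = 0 -> S n z'.
      move=> Sz' z'n i; rewrite leq_eqVlt => /orP[/eqP ni|]; last exact: Sz'.
      by rewrite -z'n; congr (_ _ 0); apply: val_inj.
    (* A kernel vector in [S n.+1] is determined by its coordinate of index [n]: subtracting the
       multiple of [e] that cancels it leaves a kernel vector in [S n], hence 0. *)
    pose c := (Gr *m e) (Ordinal ltn) 0.
    have c0 : c != 0 by apply/eqP => /(Sn _ Se)/ker0 /(_ Fe).
    have G_lin r i : (Gr *m (z - r *: e)) i 0 = (Gr *m z) i 0 - r * (Gr *m e) i 0.
      by rewrite mulmxBr -scalemxAr; move: (Gr *m z) (Gr *m e) => u v; rewrite !mxE.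
    exists ((Gr *m z) (Ordinal ltn) 0 / c).
    apply/eqP; rewrite -subr_eq0; apply/eqP/ker0.
      apply: Sn => [i lei|].
        by rewrite G_lin Sz// Se// mulr0 subr0.
      by rewrite G_lin divfK// subrr.
    by rewrite mulmxBr -scalemxAr Fz Fe scaler0 subr0.
  exists 0; split=> // z Sz Fz; exists 0; rewrite scaler0.
  by apply: contrapT => z0; apply: none; exists z.
have [e [e0 eP]] := e_line; exists e; split=> //.
(* The image of [U *m pid_mx k] is [S k], so the nearby kernel point also lies in [S k], hence on
   the line. *)
have [C C0 CP] := dist_kernel_bound residual_mx (U *m pid_mx k : 'M_(m + n)).
exists C => // a aV.
have Ba : (U *m pid_mx k : 'M_(m + n)) *m (Gr *m intv R a) = intv R a.
  have : S k (intv R a).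
    by move=> i le_ki; rewrite -intv_mul mxE GP// (leq_trans leVk).
  rewrite -mulmxA -[RHS]mul1mx -UG -[RHS]mulmxA /S => g0; congr (_ *m _).
  move: (Gr *m _) g0 => g g0.
  apply/colP => i; rewrite mxE (bigD1 i)//= big1 => [|l li]; last first.
    by rewrite mxE eq_sym val_eqE (negPf li) mul0r.
  rewrite addr0 mxE eqxx /=; have [_|le_ki] := ltnP i k; first by rewrite mul1r.
  by rewrite mul0r g0.
have [w' [Fw' w'P]] := CP (Gr *m intv R a).
have [|t tE] := eP _ _ Fw'.
  move=> i le_ki; rewrite -!mulmxA mulmxA GU mul1mx mxE big1// => l _.
  by rewrite mxE ltnNge le_ki andbF mul0r.
by exists t; rewrite -tE; move: w'P; rewrite Ba.
Qed.

End Kernel.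

(** * Dirichlet's theorem by the pigeonhole principle *)

Section Dirichlet.
Variable R : realType.

Lemma distZ_le k (xi : 'cV[R]_k) a : distZ xi <= `|xi - intv R a|.
Proof. by have [b -> ] := distZ_attained xi. Qed.

Lemma distZ_ge0 k (xi : 'cV[R]_k) : 0 <= distZ xi.
Proof. by have [b -> _] := distZ_attained xi. Qed.

(** The [(q+2)^m] integer points of the cube [[0, q+1]^m] are sorted by the fractional parts of
    their images under [Theta] into [(q+1)^n] boxes of side [1/(q+1)]; [x] is the difference of two
    points in one box. *)
Lemma dirichlet n m (Theta : 'M[R]_(n, m)) q : (0 < n <= m)%N ->
  exists x : 'cV[int]_m, [/\ x != 0, `|intv R x| <= q.+1%:R &
    distZ (Theta *m intv R x) <= q.+1%:R^-1].
Proof.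
move=> /andP[n0 le_nm]; have Q0 : 0 < q.+1%:R :> R by rewrite ltr0n.
pose vec (u : {ffun 'I_m -> 'I_q.+2}) : 'cV[int]_m := \col_i (u i)%:Z.
pose y u := Theta *m intv R (vec u).
pose fl u i := Num.floor (y u i 0).
pose fr u i := q.+1%:R * (y u i 0 - (fl u i)%:~R).
have fr0 u i : 0 <= fr u i.
  by rewrite mulr_ge0// subr_ge0 floor_le.
have frQ u i : fr u i < q.+1%:R.
  rewrite -[ltRHS]mulr1 ltr_pM2l// ltrBlDl.
  by have /andP[_] := floor_itv (y u i 0); rewrite intrD.
pose box u : {ffun 'I_n -> 'I_q.+1} := [ffun i => inord (Num.truncn (fr u i))].
have boxE u i : (box u i : nat) = Num.truncn (fr u i).
  rewrite ffunE inordK// -(ltr_nat R); apply: le_lt_trans (frQ u i).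
  by have /andP[] := truncn_itv (fr0 u i).
have /injectivePn [u [u' uu' box_uu']] : ~~ injectiveb box.
  apply: contraTN (isT : true) => /injectiveP /leq_card.
  rewrite !card_ffun !card_ord leqNgt => /negP[].
  (* Here [n <= m] enters: [(q+1)^n < (q+2)^n <= (q+2)^m]. *)
  apply: (@leq_trans (q.+2 ^ n)); first by rewrite ltn_exp2r.
  by rewrite leq_exp2l.
exists (vec u - vec u'); split.
- apply: contra_neq uu' => /eqP; rewrite subr_eq0 => /eqP /colP vv.
  by apply/ffunP => i; have := vv i; rewrite !mxE => -[] /val_inj.
- apply: norm_le_coord => [|i]; first exact: ltW.
  rewrite !mxE -intr_norm -[leRHS]/((q.+1)%:~R) ler_int.
  case: (u i) (u' i) => [a la] [b lb] /=; rewrite ler_norml. lia.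
pose b : 'cV[int]_n := \col_i (fl u i - fl u' i).
apply: le_trans (distZ_le _ b) _; apply: norm_le_coord => [|i].
  by rewrite invr_ge0 ltW.
have -> : (Theta *m intv R (vec u - vec u') - intv R b) i 0 =
    q.+1%:R^-1 * (fr u i - fr u' i).
  have bE : intv R b i 0 = (fl u i)%:~R - (fl u' i)%:~R.
    by rewrite !mxE rmorphB.
  have subE (v w : 'cV[R]_n) : (v - w) i 0 = v i 0 - w i 0 by rewrite !mxE.
  rewrite {1}/intv map_mxB mulmxBr !subE bE /fr -mulrBr mulKf ?gt_eqF//.
  by rewrite /y /intv; ring.
rewrite normrM gtr0_norm ?invr_gt0// -[leRHS]mulr1 ler_pM2l ?invr_gt0//.
have := truncn_itv (fr0 u i); have := truncn_itv (fr0 u' i).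
rewrite -!boxE box_uu'; move: (fr u i) (fr u' i) => r r'; rewrite -!natr1.
by move=> /andP[h1 h2] /andP[h3 h4]; rewrite ler_norml; lra.
Qed.

End Dirichlet.

(** * Determinants of order three and integral minors *)

Section Minors.

Local Notation i0 := (@Ordinal 3 0 isT).
Local Notation i1 := (@Ordinal 3 1 isT).
Local Notation i2 := (@Ordinal 3 2 isT).

Lemma det_mx33 (K : comNzRingType) (A : 'M[K]_3) :
  \det A = A i0 i0 * (A i1 i1 * A i2 i2 - A i2 i1 * A i1 i2)
         - A i1 i0 * (A i0 i1 * A i2 i2 - A i2 i1 * A i0 i2)
         + A i2 i0 * (A i0 i1 * A i1 i2 - A i1 i1 * A i0 i2).
Proof.
have lift_0 : lift (0 : 'I_3) (0 : 'I_2) = i1 by apply: val_inj.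
have lift_1 : lift (0 : 'I_3) (lift (0 : 'I_2) (0 : 'I_1)) = i2 by apply: val_inj.
have lift_2 : lift i1 (0 : 'I_2) = i0 by apply: val_inj.
have lift_3 : lift i1 (lift (0 : 'I_2) (0 : 'I_1)) = i2 by apply: val_inj.
have lift_4 : lift i2 (0 : 'I_2) = i0 by apply: val_inj.
have lift_5 : lift i2 (lift (0 : 'I_2) (0 : 'I_1)) = i1 by apply: val_inj.
have lift_6 : lift (lift (0 : 'I_2) (0 : 'I_1)) (0 : 'I_1) = 0 :> 'I_2 by apply: val_inj.
have i0E : (0 : 'I_3) = i0 by apply: val_inj.
rewrite (expand_det_col _ 0) !big_ord_recl big_ord0 /cofactor.
rewrite !(expand_det_col _ 0) !big_ord_recl !big_ord0 /cofactor !det_mx11 !mxE.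
have liftE := (lift_0, lift_1, lift_2, lift_3, lift_4, lift_5, lift_6).
rewrite !liftE i0E.
by rewrite (_ : ord0 = i0) /bump /=; [ring|apply: val_inj].
Qed.

Variable R : realType.

(** The arguments are columns, given as functions so that multiples of [e] and remainders can be
    mixed. *)
Definition det3 (a b c : 'I_3 -> R) : R :=
  a i0 * (b i1 * c i2 - b i2 * c i1) - a i1 * (b i0 * c i2 - b i2 * c i0)
  + a i2 * (b i0 * c i1 - b i1 * c i0).

Lemma norm_add_le (a b x y : R) : `|a| <= x -> `|b| <= y -> `|a + b| <= x + y.
Proof. by move=> ax bY; rewrite (le_trans (ler_normD _ _))// lerD. Qed.

Lemma det3_bound (a b c : 'I_3 -> R) (x y w : R) :
  (forall i, `|a i| <= x) -> (forall i, `|b i| <= y) ->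
  (forall i, `|c i| <= w) -> `|det3 a b c| <= 6 * (x * y * w).
Proof.
move=> ax bx cx.
have mul3 i j k : `|a i * b j * c k| <= x * y * w.
  by rewrite 2!normrM !ler_pM// mulr_ge0.
have -> : det3 a b c = a i0 * b i1 * c i2 + - (a i0 * b i2 * c i1) +
   - (a i1 * b i0 * c i2) + a i1 * b i2 * c i0 + a i2 * b i0 * c i1 +
   - (a i2 * b i1 * c i0) by rewrite /det3; ring.
have -> : 6 * (x * y * w) = x * y * w + x * y * w + x * y * w + x * y * w +
  x * y * w + x * y * w by ring.
by do 5![apply: norm_add_le; last by rewrite ?normrN].
Qed.

(* Expanding the determinant multilinearly, every term with two columns
   proportional to [e] vanishes. *)
Lemma det_near_line (A : 'M[R]_3) (e : 'I_3 -> R) (t X Z : 'I_3 -> R) (K : R) :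
  (forall i j, `|t j * e i| <= K * X j) ->
  (forall i j, `|A i j - t j * e i| <= K * Z j) ->
  `|\det A| <= 6 * K ^+ 3 * (X i0 * Z i1 * Z i2 + Z i0 * X i1 * Z i2 +
    Z i0 * Z i1 * X i2 + Z i0 * Z i1 * Z i2).
Proof.
move=> eX hZ; pose h j i := A i j - t j * e i; pose u j i := t j * e i.
have hB j i : `|h j i| <= K * Z j by exact: hZ.
have uB j i : `|u j i| <= K * X j by exact: eX.
have -> : \det A = det3 (u i0) (h i1) (h i2) + det3 (h i0) (u i1) (h i2) +
    det3 (h i0) (h i1) (u i2) + det3 (h i0) (h i1) (h i2).
  by rewrite det_mx33 /det3 /h /u; ring.
have -> : 6 * K ^+ 3 * (X i0 * Z i1 * Z i2 + Z i0 * X i1 * Z i2 +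
    Z i0 * Z i1 * X i2 + Z i0 * Z i1 * Z i2) =
  6 * (K * X i0 * (K * Z i1) * (K * Z i2)) +
  6 * (K * Z i0 * (K * X i1) * (K * Z i2)) +
  6 * (K * Z i0 * (K * Z i1) * (K * X i2)) +
  6 * (K * Z i0 * (K * Z i1) * (K * Z i2)) by ring.
by do 3![apply: norm_add_le; last exact: det3_bound]; exact: det3_bound.
Qed.

(** Independent columns give a matrix of full column rank, hence [k] rows with nonzero minor; this
    minor is an integer. *)
Lemma integer_minor d k (a : 'I_k -> 'cV[int]_d) :
  (forall c : 'I_k -> R, \sum_j c j *: intv R (a j) = 0 -> forall j, c j = 0) ->
  exists f : 'I_k -> 'I_d, 1 <= `|\det (\matrix_(i, j) (intv R (a j)) (f i) 0)|.
Proof.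
move=> a_free; pose A : 'M[R]_(d, k) := \matrix_(i, j) (intv R (a j)) i 0.
have Afull : row_full A.
  rewrite /row_full -mxrank_tr; apply: inj_row_free => v vA.
  apply/rowP => j; rewrite mxE; apply: (a_free (fun j => v 0 j)).
  apply/colP => i; have /rowP/(_ i) := vA; rewrite !mxE summxE => vA0.
  by rewrite -[RHS]vA0; apply: eq_bigr => l _; rewrite !mxE.
exists (fullrankfun Afull).
set B := \matrix_(i, j) _.
have BE : B = map_mx intr (\matrix_(i, j) (a j) (fullrankfun Afull i) 0).
  by apply/matrixP => i j; rewrite !mxE.
have : \det B != 0.
  rewrite -unitfE -unitmxE -row_full_unit.
  rewrite (_ : B = rowsub (fullrankfun Afull) A); last first.
    by apply/matrixP => i j; rewrite !mxE.
  exact: fullrowsub_full.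
rewrite BE det_map_mx intr_eq0 -intr_norm ler1z -gtz0_ge1 normr_gt0//.
Qed.

End Minors.

(** * Growth, decay and independence of best approximations *)

Section Sequence.
Variables (R : realType) (n m : nat) (Theta : 'M[R]_(n, m)).
Variable z : nat -> 'cV[int]_(m + n).
Hypothesis zP : best_approx_sequence Theta z.

Let X nu : R := `|intv R (usubmx (z nu))|.
Let Z nu : R := distZ (Theta *m intv R (usubmx (z nu))).

Lemma bas_residual nu : `|residual_mx Theta *m intv R (z nu)| = Z nu.
Proof.
have [_ zE] := bas_extended zP nu; rewrite /Z -zE residual_mxE.
by rewrite /intv !map_usubmx !map_dsubmx.
Qed.

Lemma bas_norm_ge nu : nu.+1%:R <= X nu.
Proof.
elim: nu => [|nu IHnu].
  by have [[x0 _] _] := bas_extended zP 0; exact: intv_norm_ge1.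
have := bas_norm zP nu; rewrite -/(X nu) -/(X nu.+1).
have [N XN] := intv_norm_nat R (usubmx (z nu.+1)); rewrite {}/X in IHnu *.
rewrite XN => /(le_lt_trans IHnu); by rewrite ltr_nat ler_nat.
Qed.

Lemma bas_norm_le : {homo X : i j / (i <= j)%N >-> i <= j}.
Proof.
by apply: homo_leq => // [? ? ?|nu]; [exact: le_trans|exact: ltW (bas_norm zP nu)].
Qed.

Lemma bas_dist_ge : {homo Z : i j / (i <= j)%N >-> j <= i}.
Proof.
apply: homo_leq => // [? ? ? h1 h2|nu]; first exact: le_trans h2 h1.
exact: ltW (bas_dist zP nu).
Qed.

(** Dirichlet's theorem is applied with [q+1 = X nu.+1 - 1]. By completeness some [z mu] does at
    least as well with norm below [X nu.+1], so [mu <= nu] and [Z nu <= 1/(q+1)]; the 2 bounds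
    [(q+2)/(q+1)]. *)
Lemma bas_uniform nu : (0 < n <= m)%N -> Z nu * X nu.+1 <= 2.
Proof.
move=> nm; have := bas_norm_ge nu.+1.
have [N XN] : exists N : nat, X nu.+1 = N%:R by exact: intv_norm_nat.
rewrite XN ler_nat; case: N XN => [|[|q]]// XN _.
have [x [x0 xX xZ]] := dirichlet Theta q nm.
have [mu [muX muZ]] := bas_complete zP x0.
have le_mu : (mu <= nu)%N.
  rewrite leqNgt; apply/negP => /bas_norm_le; rewrite leNgt => /negP[].
  by apply: le_lt_trans (le_trans muX xX) _; rewrite XN ltr_nat.
have ZQ : Z nu <= q.+1%:R^-1 := le_trans (bas_dist_ge le_mu) (le_trans muZ xZ).
apply: (@le_trans _ _ (q.+1%:R^-1 * q.+2%:R)); first by rewrite ler_wpM2r.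
by rewrite mulrC ler_pdivrMr ?ltr0n// -natrM ler_nat; lia.
Qed.

Lemma bas_dist_ge0 nu : 0 <= Z nu.
Proof. exact: distZ_ge0. Qed.

Lemma bas_norm_ge1 nu : 1 <= X nu.
Proof. by apply: le_trans (bas_norm_ge nu); rewrite ler1n. Qed.

(** [Z nu * X nu.+1] stays bounded while [X nu.+1] grows at least linearly. *)
Lemma bas_dist_small (e : R) N : (0 < n <= m)%N -> 0 < e ->
  exists2 N', (N <= N')%N & forall nu, (N' <= nu)%N -> Z nu < e.
Proof.
move=> nm e0; exists (maxn N (Num.truncn (2 / e)).+1); first exact: leq_maxl.
move=> nu; rewrite geq_max => /andP[_ le_nu].
rewrite ltNge; apply/negP => eZ; have := bas_uniform nu nm; rewrite leNgt => /negP[].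
have : 2 / e < X nu.+1.
  apply: lt_le_trans (bas_norm_ge _).
  have /andP[_ /lt_le_trans] := truncn_itv (ltW (divr_gt0 (ltr0Sn R 1) e0)).
  by apply; rewrite ler_nat (leq_trans le_nu)// (leq_trans (leqnSn _)).
rewrite ltr_pdivrMr// mulrC => /lt_le_trans; apply.
by rewrite ler_wpM2r// (le_trans ler01)// bas_norm_ge1.
Qed.

Lemma bas_extended_bound : (0 < n <= m)%N ->
  exists2 C : R, 0 <= C & forall nu, `|intv R (z nu)| <= C * X nu.
Proof.
move=> nm; have [C C0 CP] := mulmx_norm_bound Theta.
(* The 1 covers the [x] part. The [y] part differs from [Theta x], of norm at most [C * X nu], by
   [Z nu <= 2 <= 2 * X nu]. *)
exists (1 + C + 2) => [|nu]; first by lra.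
have X1 := bas_norm_ge1 nu.
have Z2 : Z nu <= 2.
  apply: le_trans (bas_uniform nu nm); rewrite ler_peMr ?bas_dist_ge0//.
  exact: bas_norm_ge1.
have CX : 0 <= C * X nu by rewrite mulr_ge0// (le_trans ler01).
apply: norm_le_coord => [|i]; first by lra.
have -> : intv R (z nu) =
    col_mx (intv R (usubmx (z nu))) (intv R (dsubmx (z nu))).
  by rewrite /intv map_usubmx map_dsubmx vsubmxK.
rewrite mxE; case: split => j.
  by apply: le_trans (coord_le_norm _ _) _; rewrite -/(X nu); lra.
apply: le_trans (coord_le_norm _ _) _.
have [_ zE] := bas_extended zP nu; rewrite -/(Z nu) in zE.
have := CP (intv R (usubmx (z nu))); rewrite -/(X nu).
set u := Theta *m _ in zE *; set v := intv R _ in zE * => uX.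
have -> : v = u - (u - v) by rewrite opprB addrC subrK.
by apply: le_trans (ler_normB _ _) _; rewrite zE; lra.
Qed.

(** A factor [k] between consecutive vectors would scale [X] and [Z] alike by [|k|], but [X]
    increases while [Z] decreases. *)
Lemma bas_pair_free nu : free [:: intv R (z nu.+1); intv R (z nu)].
Proof.
have X1 mu := bas_norm_ge1 mu.
have XE mu : X mu = `|usubmx (intv R (z mu))| by rewrite /X /intv map_usubmx.
rewrite free_cons span_seq1 seq1_free; apply/andP; split; last first.
  apply/eqP => z0; have := X1 nu; rewrite XE z0.
  by rewrite (_ : usubmx 0 = 0) ?normr0 ?ler10// linear0.
apply/negP => /vlineP[k zk]; have := bas_dist zP nu; rewrite ltNge => /negP[].
have Xk : X nu.+1 = `|k| * X nu by rewrite !XE zk linearZ normrZ.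
have Zk : Z nu.+1 = `|k| * Z nu.
  by rewrite -!bas_residual zk -scalemxAr normrZ.
rewrite -/(Z _) -/(Z _) Zk ler_peMl ?bas_dist_ge0//.
have := bas_norm zP nu; rewrite -/(X _) -/(X _) Xk leNgt => lt_kX.
apply/negP => k1; move: lt_kX; rewrite ltNge => /negP[].
by rewrite ler_piMl ?ltW// (lt_le_trans ltr01).
Qed.

(** With [e = 0], [near_line] bounds [|z_nu|] by [C * Z nu], which tends to 0, whereas a nonzero
    integer vector has norm at least 1. *)
Lemma bas_notin_small (V : {vspace 'cV[R]_(m + n)}) N :
  completely_irrational Theta -> (0 < n <= m)%N -> (\dim V <= n)%N ->
  ~ forall nu, (N <= nu)%N -> intv R (z nu) \in V.
Proof.
move=> irr nm leV zV; have ltV : (\dim V < m + n)%N by lia.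
have [e [/(_ leV) -> [C C0 CP]]] := near_line irr ltV (leqW leV).
have e0 : 0 < (C + 1)^-1 by rewrite invr_gt0 ltr_wpDl.
have [nu le_nu /(_ _ (leqnn _)) Znu] := bas_dist_small N nm e0.
have [t] := CP _ (zV _ le_nu); rewrite scaler0 subr0 bas_residual leNgt.
move=> /negP[]; apply: (@lt_le_trans _ _ 1).
  apply: (@le_lt_trans _ _ ((C + 1) * Z nu)).
    by rewrite ler_wpM2r ?bas_dist_ge0// lerDl.
  by rewrite -ltr_pdivlMl ?mulr1// -invr_gt0.
apply: intv_norm_ge1; apply: contra_eq_neq (erefl (z nu)) => z0.
have := bas_norm_ge1 nu; rewrite /X z0 linear0 /intv map_mx0 normr0.
by rewrite ler10.
Qed.

(** Consecutive pairs are independent. If all triples from [N] on were dependent, each new vector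
    would lie in the span of the previous two, so all would stay in one plane, of dimension at most
    [n]. *)
Lemma bas_triple_free N : completely_irrational Theta -> (1 < n <= m)%N ->
  exists2 nu, (N <= nu)%N &
    free [:: intv R (z nu); intv R (z nu.+1); intv R (z nu.+2)].
Proof.
move=> irr nm; apply: contrapT => none.
pose V := <<[:: intv R (z N.+1); intv R (z N)]>>%VS.
have leV : (\dim V <= n)%N.
  by apply: leq_trans (dim_span _) _; case/andP: nm.
apply: (@bas_notin_small V N irr _ leV); first by lia.
have zV k : intv R (z (N + k)%N) \in V /\ intv R (z (N + k).+1) \in V.
  elim: k => [|k [IH1 IH2]].
    by rewrite addn0 !memv_span// !inE eqxx ?orbT.
  rewrite addnS; split=> //.
  have : intv R (z (N + k).+2) \in
      <<[:: intv R (z (N + k).+1); intv R (z (N + k)%N)]>>%VS.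
    apply: contraT => zn; case: none; exists (N + k)%N; first exact: leq_addr.
    have -> : [:: intv R (z (N + k)%N); intv R (z (N + k).+1);
        intv R (z (N + k).+2)] = rev [:: intv R (z (N + k).+2);
        intv R (z (N + k).+1); intv R (z (N + k)%N)] by [].
    by rewrite (perm_free (permEl (perm_rev _))) free_cons zn bas_pair_free.
  apply: subvP; apply/span_subvP => v; rewrite !inE.
  by move=> /orP[]/eqP->.
by move=> nu le_nu; have [] := zV (nu - N)%N; rewrite subnKC.
Qed.

Lemma bas_dim_ge (V : {vspace 'cV[R]_(m + n)}) N :
  completely_irrational Theta -> (1 < n <= m)%N ->
  (forall nu, (N <= nu)%N -> intv R (z nu) \in V) -> (n + 2 <= \dim V)%N.
Proof.
move=> irr nm2 zV; rewrite leqNgt addn2 ltnS; apply/negP => leV.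
have nm : (0 < n <= m)%N by lia.
have ltV : (\dim V < m + n)%N by lia.
have [e [_ [C C0 CP]]] := near_line irr ltV leV.
have [D D0 DP] := bas_extended_bound nm.
(* [|t e| <= |z_nu| + C * Z nu <= (D + 2 * C) * X nu]; the added 1 makes [K] positive. *)
pose K := D + 2 * C + 1.
have Z_X nu : Z nu <= 2 * X nu.
  apply: (@le_trans _ _ 2); last by rewrite ler_peMr ?bas_norm_ge1.
  apply: le_trans (bas_uniform nu nm); rewrite ler_peMr ?bas_dist_ge0//.
  exact: bas_norm_ge1.
have K0 : 0 < K by rewrite /K; lra.
have [t tP] : exists t : nat -> R, forall nu, (N <= nu)%N ->
    (`|t nu *: e| <= K * X nu) /\ `|intv R (z nu) - t nu *: e| <= K * Z nu.
  suff : forall nu, exists t, (N <= nu)%N ->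
      (`|t *: e| <= K * X nu) /\ `|intv R (z nu) - t *: e| <= K * Z nu.
    by move=> /choice[t tP]; exists t.
  move=> nu; have [le_nu|_] := leqP N nu; last by exists 0.
  have [t] := CP _ (zV _ le_nu); rewrite bas_residual => tZ; exists t => _.
  have CZ : C * Z nu <= C * (2 * X nu) by rewrite ler_wpM2l.
  have X1 := bas_norm_ge1 nu; have Z0 := bas_dist_ge0 nu.
  split; last first.
    by apply: le_trans tZ _; rewrite ler_wpM2r// /K; lra.
  have -> : t *: e = intv R (z nu) - (intv R (z nu) - t *: e).
    by rewrite opprB addrC subrK.
  apply: le_trans (ler_normB _ _) _; have := DP nu; rewrite /K; lra.
(* [6 * K ^+ 3] comes from [det_near_line]. The 10 is [2 + 2 + 2 + 4]: each of the three terms with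
   one [X] is at most [2 * Z nu], the product of three [Z] at most [4 * Z nu]. *)
have [c cE c_gt0] : exists2 c, c = 6 * K ^+ 3 * 10 & 0 < c.
  by exists (6 * K ^+ 3 * 10); rewrite // !mulr_gt0// exprn_gt0.
have c0 : 0 < c^-1 by rewrite invr_gt0.
have [N' le_NN' Zsmall] := bas_dist_small N nm c0.
have [nu le_nu zfree] := bas_triple_free N' irr nm2.
pose w (j : 'I_3) := (nu + j)%N.
have le_w j : (N <= w j)%N by rewrite /w; lia.
have [|f] := @integer_minor R _ 3 (fun j => z (w j)).
  move=> a a0; pose T := [tuple intv R (z nu); intv R (z nu.+1); intv R (z nu.+2)].
  apply: (elimT (@freeP _ _ _ T) zfree a); rewrite -[RHS]a0; apply: eq_bigr => j _.
  by congr (_ *: _); case: j => [[|[|[|j]]] lt_j]//; rewrite /w /= ?addn0 ?addn1 ?addn2.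
set A := \matrix_(i, j) _ => detA.
have line_le (i j : 'I_3) : `|t (w j) * e (f i) 0| <= K * X (w j).
  have [+ _] := tP _ (le_w j); apply: le_trans.
  by apply: le_trans (coord_le_norm _ (f i)); rewrite mxE.
have off_le (i j : 'I_3) : `|A i j - t (w j) * e (f i) 0| <= K * Z (w j).
  have [_] := tP _ (le_w j); apply: le_trans.
  by apply: le_trans (coord_le_norm _ (f i)); rewrite !mxE.
have := @det_near_line R A (fun i => e (f i) 0) (fun j => t (w j))
  (fun j => X (w j)) (fun j => Z (w j)) K line_le off_le.
rewrite /w /= addn0 addn1 addn2 => /(le_trans detA); rewrite leNgt => /negP[].
have cZ : c * Z nu < 1.
  by rewrite -(mulfV (lt0r_neq0 c_gt0)) ltr_pM2l// Zsmall.
apply: le_lt_trans cZ.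
rewrite cE -(mulrA _ 10) ler_pM2l ?mulr_gt0 ?exprn_gt0//.
have Z0 k := bas_dist_ge0 k.
have X0 k : 0 <= X k := le_trans ler01 (bas_norm_ge1 k).
(* Monotonicity of [X] and [Z] compares all four terms with [Z nu * (Z nu.+1 * X nu.+2)], the one
   that [bas_uniform] controls. *)
have ZX : Z nu * (Z nu.+1 * X nu.+2) <= Z nu * 2.
  by rewrite ler_wpM2l// bas_uniform.
have h1 : X nu * (Z nu.+1 * Z nu.+2) <= X nu.+2 * (Z nu.+1 * Z nu).
  by rewrite ler_pM ?mulr_ge0 ?bas_norm_le// ?ler_wpM2l ?bas_dist_ge//; lia.
have h2 : Z nu * (X nu.+1 * Z nu.+2) <= Z nu * (X nu.+2 * Z nu.+1).
  by rewrite ler_wpM2l// ler_pM ?bas_norm_le ?bas_dist_ge.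
have h3 : Z nu * (Z nu.+1 * Z nu.+2) <= Z nu * (Z nu.+1 * (2 * X nu.+2)).
  by rewrite !ler_wpM2l.
by move: ZX h1 h2 h3; clear; lra.
Qed.

End Sequence.
Theorem theorem1 (R : realType) (n m : nat) (hn : (2 <= n)%N) (hm : (2 <= m)%N)
  (hnm : (n <= m)%N) (Theta : 'M[R]_(n, m)) :
  completely_irrational Theta -> good Theta -> (n + 2 <= asym_dim Theta)%N.
Proof.
move=> irr /asym_dimP[[z [zP [V [<- [N zV]]]]] _].
by apply: (bas_dim_ge zP irr _ zV); rewrite hn.
Qed.
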